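(* Let $b=5$. For all $n\ge1$, $$\tau(n)=\begin{cases}\tau(\lceil n/2\rceil),& n\text{ odd},\\ 1-\tau(n/2),& n\text{ even}.\end{cases}$$
   Context: Base $b=5$. For $v\in\mathbb{N}$, $s(v)$ is the sum of the base-5 digits of $v$, $f(v)=v+s(v)$, and $F(u)=|\{v\in\mathbb{N}: f(v)=u\}|$. $K(n)$ is the smallest $u\in\mathbb{N}$ with $F(u)=n$, and for $i\in\{0,2\}$, $K_i(n)$ is the smallest $u\in\mathbb{N}$ with $F(u)=n$ and $u\equiv i\pmod 4$. Since $F(u)=0$ for odd $u$ in base 5, $K(n)=\min\{K_0(n),K_2(n)\}$, and since $K_0(n)\ne K_2(n)$, there is a unique $\tau(n)\in\{0,1\}$ with $K(n)=K_{2\tau(n)}(n)$. *)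

(* Defs.v *)
From Stdlib Require Import ClassicalEpsilon.
From mathcomp Require Import all_boot.
From mathcomp Require Import zify.
Set Implicit Arguments.
Unset Strict Implicit.
Unset Printing Implicit Defensive.

(* The set of natural numbers contains 0; in particular K 1 = 0, as 0 = f 0. *)

(* The base-5 digits of v are the (v %/ 5 ^ k) %% 5; those with k >= v vanish
   because v < 5 ^ v. *)
Definition s (v : nat) : nat := \sum_(k < v) (v %/ 5 ^ k) %% 5.

Definition f (v : nat) : nat := v + s v.

(* Since v <= f v, all the solutions of f v = u lie in 'I_u.+1. *)
Definition F (u : nat) : nat := #|[set v : 'I_u.+1 | f v == u]|.

(* The least natural number satisfying P, with junk value 0 if there is none;
   see K_P and KP below for the existence in the cases of interest. *)
Definition least (P : pred nat) : nat :=
  if excluded_middle_informative (exists n, P n) is left exP then ex_minn exP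
  else 0.

Definition K (n : nat) : nat := least [pred u | F u == n].

Definition K_ (i n : nat) : nat :=
  least [pred u | (F u == n) && (u == i %[mod 4])].

(* By tau_unique below, exactly one t < 2 satisfies this predicate if n > 0. *)
Definition tau (n : nat) : nat :=
  least [pred t | (t < 2) && (K n == K_ (2 * t) n)].

Lemma leastP (P : pred nat) :
  (exists n, P n) -> P (least P) /\ forall m, P m -> least P <= m.
Proof.
rewrite /least => exP; case: excluded_middle_informative => // exP'.
by case: ex_minnP.
Qed.

Lemma s_bound N v : v < 5 ^ N -> s v = \sum_(0 <= k < N) (v %/ 5 ^ k) %% 5.
Proof.
have pad a b : v < 5 ^ a -> a <= b ->
    \sum_(0 <= k < b) (v %/ 5 ^ k) %% 5 = \sum_(0 <= k < a) (v %/ 5 ^ k) %% 5.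
  move=> va ab; rewrite (big_cat_nat (n := a)) //= [X in _ + X]big_nat.
  rewrite [X in _ + X]big1 ?addn0 // => k /andP[ak _].
  by rewrite divn_small ?mod0n // (leq_trans va) // leq_exp2l.
move=> vN; have vv : v < 5 ^ v by apply: ltn_expl.
rewrite /s -(big_mkord xpredT (fun k => (v %/ 5 ^ k) %% 5)).
by rewrite -(pad _ _ vv (leq_maxl v N)) (pad _ _ vN (leq_maxr v N)).
Qed.

Lemma s_digit d : d < 5 -> s d = d.
Proof.
by move=> d5; rewrite (@s_bound 1) // big_nat1 expn0 divn1 modn_small.
Qed.

Lemma s_cat m q r : r < 5 ^ m -> s (q * 5 ^ m + r) = s q + s r.
Proof.
move=> rm; have qq : q < 5 ^ q by apply: ltn_expl.
have vN : q * 5 ^ m + r < 5 ^ (m + q) by rewrite expnD; nia.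
rewrite (s_bound vN) (s_bound rm) (s_bound qq).
rewrite (big_cat_nat (n := m)) ?leq_addr //= addnC; congr (_ + _).
  rewrite -{1}[m]add0n (addnC m q) big_addn addnK; apply: eq_bigr => k _.
  rewrite (addnC k) expnD divnMA divnMDl ?expn_gt0 //.
  by rewrite (divn_small rm) addn0.
apply: eq_big_nat => k /andP[_ km].
have -> : q * 5 ^ m = (q * 5 ^ (m - k).-1 * 5) * 5 ^ k.
  rewrite -!mulnA -expnS -expnD (_ : _ + _ = m) //; lia.
by rewrite divnMDl ?expn_gt0 // modnMDl.
Qed.

Lemma s_step q d : d < 5 -> s (q * 5 + d) = s q + d.
Proof. by move=> d5; rewrite (@s_cat 1) // (s_digit d5). Qed.

Lemma s_compl m w : w < 5 ^ m -> s ((5 ^ m).-1 - w) + s w = 4 * m.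
Proof.
elim: m w => [|m IHm] w; first by case: w => // _; rewrite !s_digit.
rewrite expnS => wm.
have d5 : w %% 5 < 5 by rewrite ltn_mod.
have wE := divn_eq w 5.
have qm : w %/ 5 < 5 ^ m by lia.
have -> : (5 * 5 ^ m).-1 - w
    = ((5 ^ m).-1 - w %/ 5) * 5 + (4 - w %% 5) by lia.
have -> : s w = s (w %/ 5) + w %% 5 by rewrite {1}wE s_step.
rewrite s_step; last by lia.
by have := IHm _ qm; lia.
Qed.

Lemma f_even v : odd (f v) = false.
Proof.
rewrite /f; elim/ltn_ind: v => v IHv; case: (posnP v) => [-> | v0].
  by rewrite s_digit.
have q_lt : v %/ 5 < v by rewrite ltn_Pdiv.
have d5 : v %% 5 < 5 by rewrite ltn_mod.
have := IHv _ q_lt; rewrite {3 4}(divn_eq v 5) s_step //.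
lia.
Qed.

Lemma F_odd u : odd u -> F u = 0.
Proof.
move=> ou; apply/eqP; rewrite cards_eq0; apply/eqP/setP => v; rewrite !inE.
by apply/eqP => fv; move: (f_even v); rewrite fv ou.
Qed.

Lemma F_bound N u : u < N -> F u = \sum_(0 <= v < N) (f v == u).
Proof.
move=> uN; rewrite (big_cat_nat (n := u.+1)) //=.
rewrite [X in _ + X]big_nat [X in _ + X]big1 ?addn0 => [|v /andP[uv _]].
  rewrite big_mkord /F -sum1_card big_mkcond /=.
  by apply: eq_bigr => v _; rewrite inE; case: (f v == u).
by apply/eqP; rewrite eqb0; apply/eqP; rewrite /f; lia.
Qed.

Lemma expn5_big m : 4 * m < 5 ^ m.
Proof. by elim: m => // m IHm; rewrite expnS; lia. Qed.

Lemma F_shift m x y : x + y + 2 = 4 * m -> F (5 ^ m + 1 + x) = F x + F y.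
Proof.
move=> xym; have Bm := expn5_big m; set B := 5 ^ m in Bm *.
rewrite (@F_bound (B + B)); last by lia.
rewrite (@F_bound B x) ?(@F_bound B y); try by lia.
rewrite (big_cat_nat (n := B)) ?leq_addr //= addnC; congr (_ + _).
  rewrite -{1}[B]add0n big_addn addnK; apply: eq_big_nat => r /andP[_ rB].
  rewrite /f (_ : r + B = 1 * 5 ^ m + r); last by rewrite -/B; lia.
  rewrite s_cat // (@s_digit 1) // -/B; congr (nat_of_bool _); lia.
rewrite big_nat_rev /=; apply: eq_big_nat => w /andP[_ wB].
have := s_compl wB; rewrite -/B /f.
rewrite (_ : 0 + B - w.+1 = B.-1 - w); last by lia.
by move=> sw; congr (nat_of_bool _); lia.
Qed.

Lemma F_0 : F 0 = 1.
Proof. by rewrite (@F_bound 1) // big_nat1 /f s_digit. Qed.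

Lemma F_2 : F 2 = 1.
Proof.
by rewrite (@F_bound 3) // big_mkord !big_ord_recr big_ord0 /= /f !s_digit.
Qed.

Lemma F_surj n t :
  0 < n -> t < 2 -> exists u, (F u == n) && (u == 2 * t %[mod 4]).
Proof.
case: n => // n _; elim: n t => [|n IHn] t t2.
  by case: t t2 => [|[|//]] _; [exists 0; rewrite F_0 | exists 2; rewrite F_2].
have t2' : 1 - t < 2 by lia.
have [x /andP[/eqP Fx xt]] := IHn _ t2'.
have [y Fy xy] : exists2 y, F y = 1 & (x + y + 2) %% 4 = 0.
  by case: t t2 t2' xt => [|[|//]] _ _ xt;
    [exists 0; rewrite ?F_0 | exists 2; rewrite ?F_2]; move: xt; lia.
exists (5 ^ ((x + y + 2) %/ 4) + 1 + x).
rewrite (@F_shift _ x y); last by lia.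
have h5 k : 5 ^ k %% 4 = 1 by rewrite -modnXm exp1n.
by have := h5 ((x + y + 2) %/ 4); move: xt; rewrite Fx Fy; lia.
Qed.

Lemma K_P n t (u := K_ (2 * t) n) : 0 < n -> t < 2 ->
  [/\ F u = n, u = 2 * t %[mod 4] &
      forall v, F v = n -> v = 2 * t %[mod 4] -> u <= v].
Proof.
move=> n0 t2; have [/andP[/eqP ? /eqP ?] umin] := leastP (F_surj n0 t2).
by split=> // v /eqP Fv /eqP vt; apply: umin; rewrite /= Fv vt.
Qed.

Lemma KP n : 0 < n -> F (K n) = n /\ forall v, F v = n -> K n <= v.
Proof.
move=> n0; have exP : exists u, [pred u | F u == n] u.
  by have [u /andP[Fu _]] := F_surj n0 (isT : 0 < 2); exists u.
have [/eqP Fu umin] := leastP exP.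
by split=> // v /eqP; apply: umin.
Qed.

Lemma tau_unique n : 0 < n -> exists! t, (t < 2) && (K n == K_ (2 * t) n).
Proof.
move=> n0; have [FK Kmin] := KP n0.
have [] := @K_P n 0 n0 isT; have [] := @K_P n 1 n0 isT.
set k2 := K_ _ n; set k0 := K_ _ n => F2 m2 min2 F0 m0 min0.
have Kodd : odd (K n) = false.
  by case: (boolP (odd (K n))) => // /F_odd; rewrite FK; move: n0; lia.
have K_le0 := Kmin _ F0; have K_le2 := Kmin _ F2.
have [K0 | K2] : K n = 0 %[mod 4] \/ K n = 2 %[mod 4] by lia.
- have K0E := min0 _ FK K0; exists 0; split=> [|[|[|t]]] //; first by lia.
  by case/andP=> _ /eqP KE; move: m2 K0; rewrite /k2 -KE => ->.
- have K2E := min2 _ FK K2; exists 1; split=> [|[|[|t]]] //; first by lia.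
  by case/andP=> _ /eqP KE; move: m0 K2; rewrite /k0 -KE => ->.
Qed.

Lemma tauP n : 0 < n -> tau n < 2 /\ K n = K_ (2 * tau n) n.
Proof.
case/tau_unique=> t [tP _].
have [|/andP[? /eqP ?] _] := @leastP [pred t | (t < 2) && (K n == K_ (2 * t) n)].
  by exists t.
by [].
Qed.

(* Main.v *)
(* If x + y + 2 = 4 m then 5 ^ m + 1 + x has exactly F x + F y preimages, and
   conversely a number with at least two preimages is at least of this size for
   some such x, y, m, unless a smaller number has as many preimages.  So, for
   n >= 2, the values K_0(n) and K_2(n) are 5 ^ m + 1 + x for the same m, the
   least one for which x and y can be found with F x + F y >= n, and x is as
   small as possible in its residue class mod 4.  As K_i grows very fast, x and
   y must be the least numbers with n./2 and uphalf n preimages in two different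
   classes.  For n = 2 k this gives K_i(n) = 5 ^ m + 1 + K_(2-i)(k).  For
   n = 2 k + 1 one has to compare K_0(k) + K_2(k+1) with K_2(k) + K_0(k+1), and
   an induction shows that the sign of K_0(k+1) - K_2(k+1) decides. *)

Require Import Defs.
From mathcomp Require Import all_boot zify.
Set Implicit Arguments.
Unset Strict Implicit.
Unset Printing Implicit Defensive.

(** * Size estimates and small values *)

Lemma expn5_cases m : [\/ m = 0, m = 1 | 12 * m < 5 ^ m].
Proof.
elim: m => [|[|[|m]] IHm]; [exact: Or31 | exact: Or32 | exact: Or33 |].
by case: IHm => // IHm; apply: Or33; rewrite expnS; lia.
Qed.

Lemma expn5_mod4 m : 5 ^ m %% 4 = 1.
Proof. by rewrite -modnXm exp1n. Qed.

Lemma s_le m v : v < 5 ^ m -> s v <= 4 * m.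
Proof. by move=> vm; rewrite -(s_compl vm) leq_addl. Qed.

Lemma f_small v : v < 25 -> f v = v + (v %/ 5 + v %% 5).
Proof.
by move=> v25; rewrite /f {2}(divn_eq v 5) s_step ?s_digit //; lia.
Qed.

Lemma F_small u :
  u < 25 -> F u = \sum_(0 <= v < u.+1) (v + (v %/ 5 + v %% 5) == u).
Proof.
move=> u25; rewrite (@F_bound u.+1) //; apply: eq_big_nat => v /andP[_ vu].
by rewrite f_small //; lia.
Qed.

Lemma F_mod4 u : 0 < F u -> exists b : bool, u = 2 * b %[mod 4].
Proof.
move=> Fu; have : ~~ odd u by apply/negP => /F_odd Fu0; rewrite Fu0 in Fu.
by move=> ou; exists (u %% 4 == 2); lia.
Qed.

(** * Preimages by leading digit, and descent *)

Lemma sum_le_F N x (A : pred nat) :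
  (forall v, A v -> f v = x) -> \sum_(0 <= v < N) A v <= F x.
Proof.
move=> Ax; have xN : x < N + x.+1 by lia.
rewrite (F_bound xN) [leqRHS](big_cat_nat (n := N)) ?leq_addr //=.
apply: leq_trans (leq_addr _ _); apply: leq_sum => v _.
by case: (boolP (A v)) => // /Ax ->; rewrite eqxx.
Qed.

(* Since f v is about v, the preimages of z start with the digit d or d - 1.
   The exceptions are 4 = f 2 and 20 = f 14, whose preimages 2 and 14 start with
   d - 2. *)
Lemma F_lead N d u (z := d * 5 ^ N + u) :
  0 < d < 5 -> u < 5 ^ N -> z != 4 -> z != 20 ->
  F z = \sum_(0 <= v < 5 ^ N) (f v + d == u)
        + \sum_(0 <= w < 5 ^ N) (f w + u + 2 == 4 * N + d).
Proof.
move=> /andP[d0 d5] uN z4 z20; have BN := expn5_cases N.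
rewrite (@F_bound (d.-1 * 5 ^ N + (5 ^ N + 5 ^ N))); last by rewrite /z; nia.
rewrite (big_cat_nat (n := d.-1 * 5 ^ N)) ?leq_addr //=.
rewrite [X in X + _]big_nat [X in X + _]big1 ?add0n; last first.
  move=> v /andP[_ vd]; apply/eqP; rewrite eqb0; apply/eqP.
  rewrite (divn_eq v (5 ^ N)).
  have rN : v %% 5 ^ N < 5 ^ N by rewrite ltn_mod expn_gt0.
  have qd : v %/ 5 ^ N < d.-1 by rewrite ltn_divLR ?expn_gt0.
  have sr := s_le rN; move: (v %% _) (v %/ _) rN qd sr => r q rN qd sr.
  rewrite /f s_cat // (@s_digit q); last by lia.
  rewrite /z in z4 z20 *.
  by case: BN => [N0|N1|BN]; [subst N..|];
    rewrite ?expn0 ?expn1 in uN rN z4 z20 *; nia.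
rewrite -{1}[d.-1 * _]add0n big_addn
  (_ : _ + _ - _ = 5 ^ N + 5 ^ N); last by lia.
rewrite (big_cat_nat (n := 5 ^ N)) ?leq_addr //= addnC; congr (_ + _).
  rewrite -{1}[5 ^ N]add0n big_addn addnK; apply: eq_big_nat => r /andP[_ rN].
  rewrite /f (_ : r + 5 ^ N + d.-1 * 5 ^ N = d * 5 ^ N + r); last by nia.
  by rewrite s_cat // (@s_digit d) // /z; congr (nat_of_bool _); lia.
(* Reversal puts [5 ^ N - 1 - w] behind the leading digit [d - 1]; complementing the digits turns
   [s w] into [4 * N - s w]. *)
rewrite big_nat_rev /=; apply: eq_big_nat => w /andP[_ wN].
have := s_compl wN; rewrite /f.
rewrite (_ : 0 + 5 ^ N - w.+1 + d.-1 * 5 ^ N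
  = d.-1 * 5 ^ N + ((5 ^ N).-1 - w)); last by lia.
rewrite s_cat ?(@s_digit d.-1); try by lia.
move=> sw; have : d.-1 * 5 ^ N + 5 ^ N = d * 5 ^ N by nia.
by rewrite /z; move=> dE; congr (nat_of_bool _); lia.
Qed.

Lemma F_4_20 z : z = 4 \/ z = 20 -> exists2 z', F z <= F z' & 3 * z' <= 2 * z.
Proof.
have sE := (big_ord_recr, big_ord0).
by case=> ->; [exists 2 | exists 6]; rewrite // !F_small // !big_mkord !sE.
Qed.

(** Apart from 4 and 20, write [z = d * 5 ^ N + u]: the two sums of [F_lead] are at most [F x] and
    [F y] for [x = u - d] and [y = 4 * N + d - 2 - u]. If a sum or its bound vanishes, the other
    argument is small enough to serve as [z']. *)
Lemma F_descent z : 0 < z ->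
  (exists N x y, [/\ x + y + 2 = 4 * N, 0 < F x, 0 < F y, F z <= F x + F y &
     5 ^ N + 1 + x <= z /\ (z < 2 * 5 ^ N -> z = 5 ^ N + 1 + x)])
  \/ (exists2 z', F z <= F z' & 3 * z' <= 2 * z).
Proof.
move=> z0; case: (boolP ((z == 4) || (z == 20))) => [zE | /norP[z4 z20]].
  by right; apply: F_4_20; move: zE; lia.
have /andP[Nz zN] := trunc_log_bounds (isT : 1 < 5) z0.
move: (trunc_log 5 z) Nz zN => N Nz zN; rewrite expnS in zN.
have N0 : 0 < 5 ^ N by rewrite expn_gt0.
have zE := divn_eq z (5 ^ N).
have uN : z %% 5 ^ N < 5 ^ N by rewrite ltn_mod.
have d0 : 0 < z %/ 5 ^ N < 5 by rewrite divn_gt0 // Nz ltn_divLR.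
move: (z %% _) (z %/ _) zE uN d0 => u d zE uN d0.
have := F_lead d0 uN; rewrite -zE => /(_ z4 z20) FzE.
have BN := expn5_cases N.
have dz : d * 5 ^ N >= 5 ^ N by nia.
case: (leqP d u) => [du | ud]; last first.
  rewrite big1 ?add0n in FzE; last by move=> v _; apply/eqP; rewrite eqb0; lia.
  right; exists (4 * N + d - 2 - u); last first.
    by case: BN => [?|?|BN]; [subst N..|];
      rewrite ?expn0 ?expn1 in zE uN *; nia.
  rewrite FzE; apply: sum_le_F => v /eqP; lia.
have S1 : \sum_(0 <= v < 5 ^ N) (f v + d == u) <= F (u - d).
  by apply: sum_le_F => v /eqP; lia.
case: (leqP (u + 2) (4 * N + d)) => [uy | yu]; last first.
  rewrite addnC big1 ?add0n in FzE;
    last by move=> v _; apply/eqP; rewrite eqb0; lia.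
  by right; exists (u - d); [rewrite FzE | lia].
have S2 : \sum_(0 <= w < 5 ^ N) (f w + u + 2 == 4 * N + d)
    <= F (4 * N + d - 2 - u).
  by apply: sum_le_F => v /eqP; lia.
have {S1 S2} Fz : F z <= F (u - d) + F (4 * N + d - 2 - u).
  by rewrite FzE leq_add.
have small x : x <= 4 * N -2 -> 3 * x <= 2 * z.
  by case: BN => [?|?|BN]; [subst N..|]; rewrite ?expn0 ?expn1 in zE uN dz *; lia.
case: (posnP (F (u - d))) => [Fx0 | Fx].
  by right; exists (4 * N + d - 2 - u); [rewrite Fx0 in Fz | apply: small; lia].
case: (posnP (F (4 * N + d - 2 - u))) => [Fy0 | Fy].
  by right; exists (u - d); [rewrite Fy0 addn0 in Fz | apply: small; lia].
left; exists N, (u - d), (4 * N + d - 2 - u); split=> //; first by lia.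
split; first by lia.
move=> z2; have d1 : d = 1 by nia.
by lia.
Qed.

(* With at least n instead of exactly n preimages, monotonicity in n is clear;
   F_kmin shows that the two minima agree. *)
Definition kmin (b : bool) (n : nat) : nat :=
  least [pred u | (n <= F u) && (u == 2 * b %[mod 4])].

(** * Splitting [4 * m - 2] and the level *)

(** The pair [x], [4 * m - 2 - x] is what [F_shift] needs for [5 ^ m + 1 + x]; the first conjunct
    makes the truncated subtraction exact. *)
Definition splits (n m x : nat) : bool :=
  [&& x + 2 <= 4 * m, 0 < F x, 0 < F (4 * m - 2 - x)
    & n <= F x + F (4 * m - 2 - x)].

(* The exponent m in K_i(n) = 5 ^ m + 1 + x. *)
Definition level (n : nat) : nat :=
  least [pred m | has (splits n m) (iota 0 (4 * m))].

Lemma kminP b n : 0 < n ->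
  [/\ n <= F (kmin b n), kmin b n = 2 * b %[mod 4] &
      forall u, n <= F u -> u = 2 * b %[mod 4] -> kmin b n <= u].
Proof.
move=> n0; have [|/andP[? /eqP ?] umin] :=
  @leastP [pred u | (n <= F u) && (u == 2 * b %[mod 4])].
  have b2 : b < 2 by case: b.
  by have [u /andP[/eqP Fu ub]] := F_surj n0 b2; exists u; rewrite /= Fu leqnn.
by split=> // u nu /eqP ub; apply: umin; rewrite /= nu.
Qed.

Lemma kmin_leq b m n : 0 < m -> m <= n -> kmin b m <= kmin b n.
Proof.
move=> m0 mn; have [_ _ min_m] := kminP b m0.
have [Fn bn _] := kminP b (leq_trans m0 mn).
by apply: min_m => //; apply: leq_trans mn Fn.
Qed.

Lemma kmin1 b : kmin b 1 = 2 * b.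
Proof.
have [_ kb kmin_le] := kminP b (isT : 0 < 1).
have : kmin b 1 <= 2 * b by apply: kmin_le => //; case: (b); rewrite ?F_0 ?F_2.
by case: b kb {kmin_le} => /=; lia.
Qed.

Lemma splits_class n m x : splits n m x ->
  exists b : bool, x = 2 * b %[mod 4] /\ 4 * m - 2 - x = 2 * ~~ b %[mod 4].
Proof.
case/and4P=> xm /F_mod4[b xb] _ _; exists b; split=> //.
by case: b xb => /=; lia.
Qed.

Lemma splits_sym n m x : splits n m x -> splits n m (4 * m - 2 - x).
Proof.
rewrite /splits => /and4P[xm Fx Fy nF].
have -> : 4 * m - 2 - (4 * m - 2 - x) = x by lia.
by rewrite Fx Fy [F _ + _]addnC nF !andbT; lia.
Qed.

Lemma splits_pair n m x y : x + y + 2 = 4 * m -> 0 < F x -> 0 < F y ->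
  n <= F x + F y -> splits n m x.
Proof.
move=> xym Fx Fy nF; rewrite /splits (_ : 4 * m - 2 - x = y); last by lia.
by rewrite Fx Fy nF !andbT; lia.
Qed.

Lemma level_le n m x : splits n m x -> level n <= m.
Proof.
move=> nmx; have mP : [pred m | has (splits n m) (iota 0 (4 * m))] m.
  apply/hasP; exists x => //; rewrite mem_iota.
  by case/and4P: nmx => *; lia.
have [|_] := @leastP [pred m | has (splits n m) (iota 0 (4 * m))].
  by exists m.
exact.
Qed.

Lemma level_splits n (b : bool) : 1 < n ->
  exists2 x, splits n (level n) x & x = 2 * b %[mod 4].
Proof.
move=> n1; have [|/hasP[x _ nx] _] :=
  @leastP [pred m | has (splits n m) (iota 0 (4 * m))].
  have n0 : 0 < n by lia.
  have [Fx xb _] := kminP false n0; have [Fy yb _] := kminP true n0.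
  set x := kmin _ _ in Fx xb; set y := kmin _ _ in Fy yb.
  have nx : splits n ((x + y + 2) %/ 4) x by apply: (@splits_pair _ _ _ y); lia.
  exists ((x + y + 2) %/ 4); apply/hasP; exists x => //; rewrite mem_iota.
  by case/and4P: nx => *; lia.
rewrite -/(level n) in nx; have [c [xc yc]] := splits_class nx.
case: (eqVneq b c) => [-> | bc]; first by exists x.
exists (4 * level n - 2 - x); first exact: splits_sym.
by rewrite yc; move: bc; case: (b); case: (c).
Qed.

(** Descent keeps at least [n] preimages and ends in a split, whose exponent is at least
    [level n]. *)
Lemma level_lt n z : 1 < n -> n <= F z -> 5 ^ level n < z.
Proof.
move=> n1; elim/ltn_ind: z => z IHz nz.
have z0 : 0 < z by rewrite lt0n; apply: contraL nz => /eqP->; rewrite F_0; lia.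
case: (F_descent z0) =>
    [[N [x [y [xy Fx Fy Fz [Nz _]]]]] | [z' Fz zz]]; last first.
  by apply: (leq_trans (IHz z' _ _)); lia.
have /level_le lN : splits n N x by apply: (@splits_pair _ _ _ y); lia.
have : 5 ^ level n <= 5 ^ N by rewrite leq_exp2l.
by lia.
Qed.

Lemma kmin_le_splits n (b : bool) x : 1 < n -> splits n (level n) x ->
  x = 2 * ~~ b %[mod 4] -> kmin b n <= 5 ^ level n + 1 + x.
Proof.
move=> n1 /and4P[xm _ _ nF] xb.
have [_ _ kmin_le] := kminP b (ltnW n1); apply: kmin_le.
  by rewrite (@F_shift _ x (4 * level n - 2 - x)) //; lia.
(* [5 ^ m + 1] is 2 modulo 4, so adding it swaps the two classes. *)
by have := expn5_mod4 (level n); move: xb; case: b => /=; lia.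
Qed.

(** * Shape and growth of [kmin] *)

(** Descent is applied to [kmin b n]. A [z'] would exceed [5 ^ level n] by [level_lt], too much for
    two thirds of a number at most [5 ^ level n + 1 + x0]. So there is a split, and size forces its
    exponent to be [level n]. *)
Lemma kmin_splits n (b : bool) : 1 < n -> exists x,
  [/\ kmin b n = 5 ^ level n + 1 + x, splits n (level n) x &
      x = 2 * ~~ b %[mod 4]].
Proof.
move=> n1; have [x0 nx0 x0b] := level_splits (~~ b) n1.
have x0m : x0 + 2 <= 4 * level n by case/and4P: nx0.
have := kmin_le_splits n1 nx0 x0b.
have [Fk kb _] := kminP b (ltnW n1); move: (kmin b n) Fk kb => k Fk kb kx0.
have k0 : 0 < k by have := level_lt n1 Fk; lia.
have BM := expn5_big (level n).
have BM' := expn5_cases (level n).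
case: (F_descent k0) =>
    [[N [x [y [xy Fx Fy Fz [Nz zE]]]]] | [z' Fz zz]]; last first.
  have := level_lt n1 (leq_trans Fk Fz).
  by case: BM' => [M0|M1|];
    [rewrite M0 in x0m | rewrite M1 in kx0 x0m * |]; lia.
have nx : splits n N x by apply: (@splits_pair _ _ _ y); lia.
have lN := level_le nx.
have NE : N = level n.
  apply/eqP; rewrite eqn_leq lN andbT leqNgt; apply/negP => lN'.
  have : 5 ^ (level n).+1 <= 5 ^ N by rewrite leq_exp2l.
  by rewrite expnS; lia.
subst N; exists x; have kE : k = 5 ^ level n + 1 + x by apply: zE; lia.
split=> //; have := expn5_mod4 (level n); move: kb; rewrite kE.
by case: b {x0b} => /=; lia.
Qed.

(** For [n > 1] the level strictly increases from [n] to [n.+1]: in a split for [n.+1], one member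
    can be replaced by a smaller one of its class, leaving at least [n] preimages. With
    [l = level n], the two values are then below [2 * 5 ^ l] and above [5 ^ l.+1]. *)
Lemma kmin_growth n b c : 0 < n -> 2 * kmin b n < kmin c n.+1.
Proof.
elim/ltn_ind: n b c => n IHn b c n0.
have [Fk _ _] := kminP c (isT : 0 < n.+1).
have kl : 5 ^ level n.+1 < kmin c n.+1 by apply: level_lt.
have [x nx xc] := level_splits true (n0 : 1 < n.+1).
have [xm Fx Fy nF] := and4P nx.
have l0 : 0 < level n.+1 by lia.
have [n1 | n1] := leqP n 1.
  have nE : n = 1 by lia.
  have : 5 ^ 1 <= 5 ^ level n.+1 by rewrite leq_exp2l.
  by rewrite [in kmin b n]nE kmin1; case: (b); lia.
suff lt_level : level n < level n.+1.
  have : 5 ^ (level n).+1 <= 5 ^ level n.+1 by rewrite leq_exp2l.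
  have [y [-> ny yb]] := kmin_splits b n1.
  have [ym _ _ _] := and4P ny.
  by have := expn5_big (level n); rewrite expnS; lia.
have {x nx xc xm Fx Fy nF} [x nx Fy1] :
    exists2 x, splits n.+1 (level n.+1) x & 1 < F (4 * level n.+1 - 2 - x).
  case: (ltnP 1 (F (4 * level n.+1 - 2 - x))) => [Fy1 | Fy1]; first by exists x.
  exists (4 * level n.+1 - 2 - x); first exact: splits_sym.
  by rewrite (_ : _ - (_ - x) = x); lia.
have [d [xd yd]] := splits_class nx.
have [xm Fx Fy nF] := and4P nx.
set y := 4 * level n.+1 - 2 - x in Fy1 yd Fy nF.
(* The cap at [n] gives [p < n] for the induction; where it takes effect, [0 < F x] supplies the
   missing preimage. *)
have [p pn py] : exists2 p, 0 < p < n & (p.+1 <= F y) && (n <= F x + p).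
  by exists (minn (F y) n).-1; lia.
have [p0 pn'] := andP pn; have [pFy nFx] := andP py.
have [_ _ kmin_le] := kminP (~~ d) (isT : 0 < p.+1).
have ky : kmin (~~ d) p < y.
  apply: leq_trans (kmin_le y pFy yd).
  by have := IHn p pn' (~~ d) (~~ d) p0; lia.
have [Fk' kd _] := kminP (~~ d) p0.
have : splits n ((x + kmin (~~ d) p + 2) %/ 4) x.
  apply: (@splits_pair _ _ _ (kmin (~~ d) p)); lia.
move/level_le; rewrite /y in yd ky.
by lia.
Qed.

Lemma F_kmin b n : 0 < n -> F (kmin b n) = n.
Proof.
move=> n0; have [Fk kb _] := kminP b n0; apply/eqP; rewrite eqn_leq Fk andbT.
rewrite leqNgt; apply/negP => Fk'.
have [_ _ kmin_le] := kminP b (isT : 0 < n.+1).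
by have := kmin_le _ Fk' kb; have := kmin_growth b b n0; lia.
Qed.

Lemma K_kmin (b : bool) n : 0 < n -> K_ (2 * b) n = kmin b n.
Proof.
move=> n0; have b2 : b < 2 by case: b.
have [FK Kb K_le] := K_P n0 b2.
have [Fk kb k_le] := kminP b n0.
apply/eqP; rewrite eqn_leq k_le ?FK // K_le //; exact: F_kmin.
Qed.

Lemma tau_kmin n : 0 < n -> tau n = (kmin true n < kmin false n).
Proof.
move=> n0; have [t2 KE] := tauP n0; have [FK K_le] := KP n0.
have /= := K_le _ (F_kmin true n0); have := K_le _ (F_kmin false n0).
have := K_kmin true n0; have := K_kmin false n0.
have [_ k0 _] := kminP false n0; have [_ k1 _] := kminP true n0.
by case: (tau n) t2 KE => [|[|//]] _ -> /=; lia.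
Qed.

(** * Halving the index *)

(** By growth, no member of a split at [level n] has more than [h] preimages; as [n = k + h], one
    has at least [h] and the other at least [k]. The cheaper assignment of classes fixes the
    level. *)
Lemma kmin_half b n (k := n./2) (h := uphalf n) (c := 5 ^ level n + 1) :
    1 < n ->
    h = k \/ kmin b k + kmin (~~ b) h < kmin (~~ b) k + kmin b h ->
  kmin (~~ b) n = c + kmin b k /\ kmin b n = c + kmin (~~ b) h.
Proof.
move=> n1 hk; have k0 : 0 < k by lia.
have h0 : 0 < h by lia.
have level_ub d : 4 * level n <= kmin d k + kmin (~~ d) h + 2.
  have [Fx xd _] := kminP d k0; have [Fy yd _] := kminP (~~ d) h0.
  have : splits n ((kmin d k + kmin (~~ d) h + 2) %/ 4) (kmin d k).
    apply: (@splits_pair _ _ _ (kmin (~~ d) h)); lia.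
  by move/level_le; lia.
have kh d : kmin d k <= kmin d h by apply: kmin_leq; lia.
have splitsP (d : bool) x (y := 4 * level n - 2 - x) :
    splits n (level n) x -> x = 2 * d %[mod 4] ->
  kmin d k <= x /\ kmin (~~ d) h <= y \/ kmin d h <= x /\ kmin (~~ d) k <= y.
  move=> nx xd; have [e [xe ye]] := splits_class nx.
  have de : e = d by move: xd xe; case: (d) (e) => [] [] /=; lia.
  rewrite {}de -/y in ye {xe}; have [xm Fx Fy nF] := and4P nx.
  rewrite -/y in Fy nF.
  have low (g : bool) v m :
      v = 2 * g %[mod 4] -> 0 < m -> m <= F v -> kmin g m <= v.
    by move=> vg m0 mF; have [_ _] := kminP g m0; apply.
  have big (g : bool) v :
      v = 2 * g %[mod 4] -> v + 2 <= 4 * level n -> F v <= h.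
    move=> vg vm; rewrite leqNgt; apply/negP => Fv.
    have := low _ _ _ vg (isT : 0 < h.+1) Fv.
    have := kmin_growth true g h0; have := kmin_growth false g h0.
    by have := level_ub true; have := kh true; have := kh false => /=; lia.
  have Fxh := big _ _ xd xm.
  have Fyh : F y <= h by apply: big ye _; lia.
  case: (leqP h (F y)) => [Fy' | Fy'].
    by left; split; apply: low => //; lia.
  by right; split; apply: low => //; lia.
have [x [-> nx /(splitsP _ _ nx) Px]] := kmin_splits (~~ b) n1.
have [y [-> ny /(splitsP _ _ ny) Py]] := kmin_splits b n1.
have [xm _ _ _] := and4P nx; have [ym _ _ _] := and4P ny.
(* The members add up to [4 * level n - 2], which [level_ub] bounds by the cheaper sum, so the
   bounds from [splitsP] are attained. *)
have := level_ub b; have := level_ub (~~ b); rewrite negbK in Px Py *.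
by case: hk => [hk | hk]; [rewrite hk in Px Py *|]; rewrite /c; lia.
Qed.

Lemma kmin_neq n : 0 < n -> kmin true n <> kmin false n.
Proof.
move=> n0; have [_ k0 _] := kminP false n0; have [_ k1 _] := kminP true n0.
by lia.
Qed.

Lemma kmin_double b k : 0 < k ->
  kmin b k.*2 = 5 ^ level k.*2 + 1 + kmin (~~ b) k.
Proof.
move=> k0; have [||_ ->] := @kmin_half b k.*2; [lia | left; lia |].
by rewrite uphalf_double.
Qed.

Lemma kmin_doubleS b k (c := 5 ^ level k.*2.+1 + 1) : 0 < k ->
    kmin b k + kmin (~~ b) k.+1 < kmin (~~ b) k + kmin b k.+1 ->
  kmin (~~ b) k.*2.+1 = c + kmin b k /\ kmin b k.*2.+1 = c + kmin (~~ b) k.+1.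
Proof.
move=> k0 lt_b; have := @kmin_half b k.*2.+1.
by rewrite /= uphalf_double doubleK; apply; [lia | right].
Qed.

(* The two values at k or the two at k.+1 (whichever index is odd) differ by far
   more than those at the even index.  If k.+1 is even, the induction hypothesis
   shows that the differences at k and k.+1 have opposite signs. *)
Lemma cheaper_split b k : 0 < k -> kmin (~~ b) k.+1 < kmin b k.+1 ->
  kmin b k + kmin (~~ b) k.+1 < kmin (~~ b) k + kmin b k.+1.
Proof.
elim/ltn_ind: k b => k IHk b k0.
have grow d e m : 0 < m -> kmin d m < kmin e m.+1.
  by move=> m0; have := kmin_growth d e m0; lia.
have trich l : 0 < l -> exists d, kmin (~~ d) l < kmin d l.
  move=> l0; have := kmin_neq l0;
  by case: (ltngtP (kmin true l) (kmin false l)) => // ? _;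
    [exists false | exists true].
have := odd_double_half k; case: (odd k) => /= kE; last first.
  rewrite add0n in kE; move: (k./2) kE => l kE; subst k.
  have l0 : 0 < l by lia.
  have [d dl] := trich l.+1 isT.
  have lk : l < l.*2 by lia.
  have [E1 E2] := kmin_doubleS l0 (IHk l lk d l0 dl).
  have := kmin_double d l0; have := kmin_double (~~ d) l0; rewrite negbK.
  have := grow d (~~ d) l l0; have := grow (~~ d) (~~ d) l l0.
  have := grow d d l l0.
  (* Only [b = d] fits the hypothesis, and [kmin (~~ d) l < kmin (~~ d) l.+1] is what remains. *)
  by case: b d {dl} E1 E2 => [] [] /= -> ->; lia.
rewrite add1n in kE; move: (k./2) kE => l kE; subst k.
rewrite -doubleS !kmin_double // negbK.
case: (posnP l) => [-> | l0].
  by rewrite !kmin1; case: b => /=; lia.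
move=> lt_b; have lk : l < l.*2.+1 by lia.
have [] := kmin_doubleS l0 (IHk l lk (~~ b) l0 _); first by rewrite negbK; lia.
by rewrite negbK => -> ->; have := grow (~~ b) (~~ b) l l0; lia.
Qed.

Theorem theorem8p1 (n : nat) (hn : 1 <= n) :
  tau n = if odd n then tau (uphalf n) else 1 - tau n./2.
Proof.
have := odd_double_half n; case: (odd n) => /=; last first.
  move=> nE; have k0 : 0 < n./2 by lia.
  rewrite -{1}nE add0n !tau_kmin // ?double_gt0 // !kmin_double //=.
  by have := kmin_neq k0; lia.
move=> nE; rewrite -nE add1n /= doubleK; move: n./2 => {hn nE} k.
case: (posnP k) => [-> // | k0]; rewrite !tau_kmin //.
have k1 := kmin_growth true false k0; have k2 := kmin_growth false true k0.
have := kmin_neq (isT : 0 < k.+1).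
case: (ltngtP (kmin true k.+1) (kmin false k.+1)) => // lt _.
  (* By growth [kmin true] at [k.*2.+1], built from index [k], is less than [kmin false], built from
     [k.+1]. *)
  have := @cheaper_split false k k0 lt; move/(kmin_doubleS k0) => /= [-> ->].
  by lia.
have := @cheaper_split true k k0 lt; move/(kmin_doubleS k0) => /= [-> ->].
by lia.
Qed.
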